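(* Let $G$ be a $d$-regular graph of diameter $2$ with $n$ vertices. Then $$\lambda(G)\le \frac{1+\sqrt{1+4(d^2+d-n)}}{2}.$$
   Context: Graphs are finite, simple and undirected. If $\lambda_1\ge\lambda_2\ge\dots\ge\lambda_n$ are the eigenvalues (with multiplicity) of the adjacency matrix of the $d$-regular graph $G$ (so $\lambda_1=d$), then $\lambda(G):=\max\{|\lambda_2|,|\lambda_n|\}$. The diameter is the maximum distance between two vertices. *)

(* Defs.v *)
From mathcomp Require Import all_boot all_order all_algebra.
From mathcomp Require Import spectral polyrcf complex.

Set Implicit Arguments.
Unset Strict Implicit.
Unset Printing Implicit Defensive.

Import Order.TTheory GRing.Theory Num.Theory.
Local Open Scope ring_scope.

Record sgraph := SGraph {
  vertex :> finType;
  adj : rel vertex;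
  adj_sym : symmetric adj;
  adj_irrefl : irreflexive adj
}.

Definition regular (G : sgraph) (d : nat) : Prop :=
  forall v : G, #|[pred w | adj v w]| = d.

(* [u :: p] is a path of [G] from [u] to [v], with [size p] edges. *)
Definition is_path (G : sgraph) (u v : G) (p : seq G) : bool :=
  [&& path (@adj G) u p, uniq (u :: p) & last u p == v].

Definition is_dist (G : sgraph) (u v : G) (k : nat) : Prop :=
  (exists2 p, is_path u v p & size p = k) /\
  (forall p, is_path u v p -> (k <= size p)%N).

(* Vertices in distinct components are at no distance from each other, so that
   a disconnected graph has no diameter in [nat]. *)
Definition has_diameter (G : sgraph) (k : nat) : Prop :=
  (forall u v : G, exists2 m, is_dist u v m & (m <= k)%N) /\
  (exists u v : G, is_dist u v k).

Definition adjmx (R : nzRingType) (G : sgraph) : 'M[R]_#|G| :=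
  \matrix_(i, j) (adj (enum_val i) (enum_val j))%:R.

(* The eigenvalues of [A] in [R], in nonincreasing order, each repeated
   according to its algebraic multiplicity. *)
Definition eigenvalues (R : rcfType) (n : nat) (A : 'M[R]_n) : seq R :=
  sort >=%R (flatten [seq nseq (mup x (char_poly A)) x
                     | x <- rootsR (char_poly A)]).

(* With 0-based indexing, the second and the last eigenvalue; by
   [size_eigenvalues] the default value 0 is only used if [#|G| < 2]. *)
Definition lambda (R : rcfType) (G : sgraph) : R :=
  let s := eigenvalues (adjmx R G) in
  Num.max `|s`_1| `|s`_(#|G|.-1)|.

Lemma char_poly_conj (F : fieldType) n (P D : 'M[F]_n) : P \in unitmx ->
  char_poly (invmx P *m D *m P) = char_poly D.
Proof.
move=> uP; rewrite /char_poly.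
have PP : map_mx polyC (invmx P) *m map_mx polyC P = 1%:M.
  by rewrite -map_mxM mulVmx // map_mx1.
have -> : char_poly_mx (invmx P *m D *m P) =
    map_mx polyC (invmx P) *m char_poly_mx D *m map_mx polyC P.
  by rewrite mulmxBr mulmxBl -!map_mxM scalar_mxC -(mulmxA _%:M) PP mulmx1.
by rewrite !det_mulmx mulrAC -det_mulmx PP det1 mul1r.
Qed.

Lemma symm_char_poly_split (R : rcfType) n (A : 'M[R]_n) : A^T = A ->
  exists s : seq R, char_poly A = \prod_(x <- s) ('X - x%:P).
Proof.
move=> symA; pose f := real_complex R; pose B : 'M[R[i]]_n := map_mx f A.
have rB : B^T = B by rewrite /B map_trmx symA.
have realB : map_mx Num.conj B = B.
  apply/matrixP=> i j; rewrite !mxE; apply/CrealP.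
  by apply/complex_realP; exists (A i j).
have hB : B \is hermsymmx.
  by apply/is_hermitianmxP; rewrite expr0 scale1r rB realB.
have /orthomx_spectralP eB := hermitian_normalmx hB.
have := hermitian_spectral_diag_real hB.
set dg := spectral_diag B in eB *; move=> /mxOverP dgR.
exists [seq complex.Re (dg 0 i) | i <- enum 'I_n].
apply: (map_poly_inj f); rewrite map_char_poly -/B eB char_poly_conj.
  rewrite char_poly_trig ?diag_mx_is_trig // rmorph_prod big_map big_enum /=.
  apply: eq_bigr => i _; rewrite rmorphB /= map_polyX map_polyC /= !mxE eqxx.
  by have /complex_realP [r ->] := dgR 0 i.
exact: spectral_unit.
Qed.

Lemma eigenvaluesP (R : rcfType) n (A : 'M[R]_n) : A^T = A ->
  char_poly A = \prod_(x <- eigenvalues A) ('X - x%:P).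
Proof.
move=> /symm_char_poly_split [s es].
suff /(perm_big _) <- : perm_eq s (eigenvalues A) by [].
rewrite perm_sym /eigenvalues perm_sort; set p := char_poly A in es *.
have p0 : p != 0 by rewrite monic_neq0 ?char_poly_monic.
have ms x : mup x p = count_mem x s.
  by rewrite es mu_prod_XsubC.
have rs : rootsR p =i undup s.
  move=> x; rewrite mem_undup -(roots_on_rootsR p0) inE es.
  by rewrite root_prod_XsubC.
have us : uniq (rootsR p) by apply: uniq_roots.
apply: perm_trans _ (perm_count_undup s).
have prs : perm_eq (rootsR p) (undup s) by apply: uniq_perm; rewrite ?undup_uniq.
rewrite (eq_map (fun x => congr1 (nseq^~ x) (ms x))).
exact/perm_flatten/perm_map.
Qed.

Lemma size_eigenvalues (R : rcfType) n (A : 'M[R]_n) : A^T = A -> size (eigenvalues A) = n.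
Proof.
move=> /eigenvaluesP e; apply: succn_inj.
by rewrite -(size_char_poly A) e size_prod_XsubC.
Qed.

Lemma eigenvalues_sorted (R : rcfType) n (A : 'M[R]_n) : sorted >=%R (eigenvalues A).
Proof. by apply: sort_sorted => x y; apply: le_total. Qed.

Lemma adjmx_sym (R : nzRingType) (G : sgraph) : (adjmx R G)^T = adjmx R G.
Proof. by apply/matrixP=> i j; rewrite !mxE adj_sym. Qed.

(* Main.v *)
(* The matrix N = A^2 + A - (d - 1) I - J has nonnegative entries (diameter 2
   gives nonadjacent vertices a common neighbour) and constant line sums
   d^2 + 1 - n, which therefore bounds the modulus of its eigenvalues.
   Eigenvalues mu of A on the vectors orthogonal to the all-ones vector give
   eigenvalues mu^2 + mu - (d - 1) of N, so mu^2 - |mu| <= d^2 + d - n. *)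
Require Import Defs.
From mathcomp Require Import all_boot all_order all_algebra.
From mathcomp Require Import lra.

Set Implicit Arguments.
Unset Strict Implicit.
Unset Printing Implicit Defensive.

Import Order.TTheory GRing.Theory Num.Theory.
Local Open Scope ring_scope.

Lemma char_poly_ublock (R : comNzRingType) m n
    (A : 'M[R]_m) (B : 'M_(m, n)) (C : 'M_n) :
  char_poly (block_mx A B 0 C) = char_poly A * char_poly C.
Proof.
rewrite /char_poly /char_poly_mx map_block_mx map_mx0 scalar_mx_block.
by rewrite opp_block_mx add_block_mx oppr0 addr0 det_ublock.
Qed.

(* In a basis starting with [u] the matrix is block triangular; the quotient
   [q] is the characteristic polynomial of the second diagonal block, whose
   left eigenvectors extended by 0 are orthogonal to [u]. *)
Lemma char_poly_deflation (F : fieldType) n (A : 'M[F]_n) (u : 'cV_n) (a : F) :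
    u != 0 -> A *m u = a *: u ->
  exists2 q, char_poly A = ('X - a%:P) * q &
    forall x, root q x ->
      exists v : 'rV_n, [/\ v != 0, v *m A = x *: v & v *m u = 0].
Proof.
case: n => [|m] in A u *; first by rewrite flatmx0 eqxx.
move=> u0 Au; pose P := col_ebase u; pose k := row_ebase u.
have uP : P \in unitmx := col_ebase_unit u.
have uk : k \in unitmx := row_ebase_unit u.
pose e : 'cV[F]_(1 + m) := col_mx 1%:M 0.
(* A nonzero column has rank 1, so its rank factorisation has middle factor [e], with [k] an
   invertible 1 by 1 matrix. Hence the first column of [P] spans the same line as [u]. *)
have Pek : P *m e *m k = u.
  rewrite -[RHS]mulmx_ebase -mxrank_tr rank_rV -(inj_eq trmx_inj) trmxK trmx0 u0.
  by congr (_ *m _ *m _); rewrite /e -pid_mx_col.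
pose M : 'M[F]_(1 + m) := invmx P *m A *m P.
have Me : M *m e = a *: e.
  apply: (can_inj (mulmxK uk)); rewrite -!mulmxA (mulmxA P) Pek Au.
  by rewrite -scalemxAr -Pek -mulmxA mulKmx // scalemxAl.
have Ml : lsubmx M = a *: e.
  by rewrite -Me -{2}[M]hsubmxK mul_row_col mulmx1 mulmx0 addr0.
pose C := usubmx (rsubmx M); pose B := dsubmx (rsubmx M).
have eM : M = block_mx a%:M C 0 B.
  rewrite block_mxEh vsubmxK -[LHS]hsubmxK Ml /e scale_col_mx scaler0.
  by rewrite scalemx1.
exists (char_poly B).
  rewrite -(char_poly_conj A uP) -/M eM (@char_poly_ublock _ 1 m).
  by rewrite /char_poly /char_poly_mx map_scalar_mx -raddfB det_scalar.
move=> x; rewrite -eigenvalue_root_char => /eigenvalueP [w wB w0].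
pose w' : 'rV[F]_(1 + m) := row_mx 0 w.
have w'M : w' *m M = x *: w'.
  by rewrite eM /w' mul_row_block !mul0mx mulmx0 !add0r wB scale_row_mx scaler0.
have w'e : w' *m e = 0 by rewrite mul_row_col mul0mx mulmx0 addr0.
exists (w' *m invmx P); split.
- apply: contra_neq w0 => /(canRL (mulmxKV uP)); rewrite mul0mx => w'0.
  by rewrite -[w](row_mxKr (0 : 'rV_1)) -/w' w'0 linear0.
- by rewrite scalemxAl -w'M /M -!mulmxA mulmxV // mulmx1.
- by rewrite -Pek !mulmxA mulmxKV // w'e mul0mx.
Qed.

(** Compare both sides of [v *m N = t *: v] at an index [i] where [|v 0 i|] is largest: column [i]
    of [N] weights entries of modulus at most [|v 0 i|] with total weight [r]. *)
Lemma eigenvalue_le_col_sum (R : realFieldType) n (N : 'M[R]_n) (v : 'rV_n)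
    (r t : R) :
    (forall i j, 0 <= N i j) -> (forall j, \sum_i N i j = r) ->
  v *m N = t *: v -> v != 0 -> `|t| <= r.
Proof.
move=> N0 Nr vN /rV0Pn [i0 vi0].
case: (@arg_maxP _ _ _ i0 predT (fun i => `|v 0 i|)) => // i _ imax.
have vi : 0 < `|v 0 i| by rewrite (lt_le_trans _ (imax i0 _)) ?normr_gt0.
rewrite -(ler_pM2r vi) -normrM.
have -> : t * v 0 i = \sum_j v 0 j * N j i.
  by move/rowP/(_ i): vN; rewrite !mxE.
rewrite (le_trans (ler_norm_sum _ _ _)) // -(Nr i) mulr_suml.
apply: ler_sum => j _; rewrite normrM mulrC (ger0_norm (N0 _ _)).
by rewrite ler_wpM2l //; apply: imax.
Qed.

Lemma adjmx_col_sum (R : nzRingType) (G : sgraph) d (j : 'I_#|G|) :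
  regular G d -> \sum_i adjmx R G i j = d%:R.
Proof.
move=> regG; under eq_bigr do rewrite mxE adj_sym.
rewrite -(big_enum_val (A := G) (fun v => (adj (enum_val j) v)%:R)) /=.
rewrite -natr_sum -(regG (enum_val j)) -sum1_card [in RHS]big_mkcond /=.
by congr _%:R; apply: eq_big => // w _; rewrite inE; case: adj.
Qed.

(** A shortest path has at most two edges; zero would force [u = v] and one would force adjacency,
    so the middle vertex of a two-edge path serves. *)
Lemma diameter2_common_neighbour (G : sgraph) (u v : G) :
    has_diameter G 2 -> u != v -> ~~ adj u v ->
  exists w, adj u w && adj w v.
Proof.
move=> [diamG _] uv auv; have [m [[p pP <-] _]] := diamG u v.
case: p pP => [|x [|y [|//]]] /and3P [/= pP _ /eqP lv] _.
- by rewrite lv eqxx in uv.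
- by rewrite -lv; move: pP auv; rewrite lv andbT => ->.
- by exists x; rewrite -lv; case/and3P: pP => -> ->.
Qed.

(** Two vertices at distance 2 are distinct, since otherwise the empty path would be shorter. This
    ensures that a second eigenvalue exists. *)
Lemma diameter2_card_gt1 (G : sgraph) : has_diameter G 2 -> (1 < #|G|)%N.
Proof.
move=> [_ [u [v [_ dmin]]]]; apply/card_gt1P; exists u, v; split=> //.
apply/negP => uv; have := dmin [::]; rewrite /is_path /= uv => /(_ isT).
by [].
Qed.

Lemma eigenvalue_orth_ones_bound (R : realFieldType) (G : sgraph) d
    (v : 'rV[R]_#|G|) (x : R) :
    regular G d -> has_diameter G 2 ->
    v != 0 -> v *m adjmx R G = x *: v -> v *m (const_mx 1 : 'cV_#|G|) = 0 ->
  x ^+ 2 - `|x| <= d%:R ^+ 2 + d%:R - #|G|%:R.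
Proof.
move=> regG diamG v0 vA v1; set A := adjmx R G in vA.
pose N : 'M[R]_#|G| := A *m A + A - (d%:R - 1)%:M - const_mx 1.
have vN : v *m N = (x ^+ 2 + x - (d%:R - 1)) *: v.
  have vJ : v *m (const_mx 1 : 'M_#|G|) = 0.
    apply/rowP=> j; move/colP/(_ 0): v1; rewrite !mxE => v1.
    by rewrite -[RHS]v1; apply: eq_bigr => i _; rewrite !mxE.
  rewrite /N !mulmxBr mulmxDr mulmxA vA -scalemxAl vA vJ subr0 mul_mx_scalar.
  by rewrite scalerA -scalerDl -scalerBl expr2.
have A01 i j : 0 <= A i j by rewrite mxE ler0n.
have N0 i j : 0 <= N i j.
  have AA0 : 0 <= (A *m A) i j by rewrite mxE sumr_ge0 // => k _; rewrite mulr_ge0.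
  have NE : N i j = (A *m A) i j + A i j - (d%:R - 1) *+ (i == j) - 1.
    by rewrite !mxE.
  rewrite {}NE; case: eqVneq => [<-|ij].
    (* The diagonal of [A *m A] holds the degrees, so [N i i] reduces to [A i i]. *)
    suff -> : (A *m A) i i = d%:R by rewrite mulr1n; have := A01 i i; lra.
    rewrite -(adjmx_col_sum R i regG) mxE; apply: eq_bigr => k _.
    by rewrite !mxE adj_sym -natrM mulnb andbb.
  rewrite subr0; case: (boolP (adj (enum_val i) (enum_val j))) => aij.
    have -> : A i j = 1 by rewrite mxE aij.
    by lra.
  have -> : A i j = 0 by rewrite mxE (negbTE aij).
  have [|w /andP [aiw awj]] := diameter2_common_neighbour diamG _ aij.
    by rewrite (inj_eq enum_val_inj).
  (* The common neighbour [w] contributes a term 1 to [(A *m A) i j], which offsets the 1 subtracted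
     by the all-ones matrix. *)
  rewrite addr0 subr_ge0 mxE (bigD1 (enum_rank w)) //= !mxE enum_rankK aiw awj.
  by rewrite mulr1 lerDl sumr_ge0 // => k _; rewrite mulr_ge0.
have NS j : \sum_i N i j = d%:R ^+ 2 + 1 - #|G|%:R.
  have -> : \sum_i N i j = \sum_i (A *m A) i j + \sum_i A i j
      - \sum_i (d%:R - 1) *+ (i == j) - \sum_(i < #|G|) 1.
    by rewrite -!sumrN -!big_split; apply: eq_bigr => i _; rewrite !mxE.
  rewrite (adjmx_col_sum _ _ regG) sumr_const card_ord.
  have -> : \sum_i (d%:R - 1) *+ (i == j) = d%:R - 1 :> R.
    by rewrite (bigD1 j) //= eqxx big1 ?addr0 // => i /negbTE ->.
  suff -> : \sum_i (A *m A) i j = d%:R ^+ 2 by lra.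
  under eq_bigr do rewrite mxE.
  rewrite exchange_big /=; under eq_bigr do rewrite -mulr_suml (adjmx_col_sum _ _ regG).
  by rewrite -mulr_sumr (adjmx_col_sum _ _ regG) expr2.
have {v0 v1 vA vN} := eigenvalue_le_col_sum N0 NS vN v0.
rewrite ler_norml => /andP [_ xle].
have : - x <= `|x| by rewrite ler_normr lexx orbT.
by lra.
Qed.

(** Completing the square: [(2 * y - 1) ^+ 2 = 1 + 4 * (y ^+ 2 - y)]. *)
Lemma le_quadratic_root (R : rcfType) (y K : R) :
  y ^+ 2 - y <= K -> y <= (1 + Num.sqrt (1 + 4 * K)) / 2.
Proof.
move=> yK; have yK' : (2 * y - 1) ^+ 2 <= 1 + 4 * K by lra.
have : 2 * y - 1 <= Num.sqrt (1 + 4 * K).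
  by rewrite (le_trans (ler_norm _)) // -sqrtr_sqr ler_wsqrtr.
lra.
Qed.

Theorem theorem3p2 (R : rcfType) (G : sgraph) (d n : nat)
    (cardG : #|G| = n) (regG : regular G d) (diamG : has_diameter G 2) :
  lambda R G <=
    (1 + Num.sqrt (1 + 4 * (d%:R ^+ 2 + d%:R - n%:R))) / 2.
Proof.
have n1 := diameter2_card_gt1 diamG.
pose u : 'cV[R]_#|G| := const_mx 1.
have u0 : u != 0.
  apply/eqP => /colP /(_ (Ordinal (ltnW n1))) /eqP.
  by rewrite !mxE oner_eq0.
have Au : adjmx R G *m u = d%:R *: u.
  apply/colP=> i; rewrite !mxE mulr1 -[RHS](adjmx_col_sum R i regG).
  by apply: eq_bigr => k _; rewrite !mxE mulr1 adj_sym.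
have [q eq_q qroot] := char_poly_deflation u0 Au.
have sA := adjmx_sym R G.
have es := eigenvaluesP sA; have := eigenvalues_sorted (adjmx R G).
have := size_eigenvalues sA; rewrite /lambda.
case: eigenvalues es => [|s0 s] es /= ss srt; first by rewrite -ss in n1.
(* The column-sum bound applied to the adjacency matrix itself, whose columns sum to [d]. *)
have s0_le : s0 <= d%:R.
  have : root (char_poly (adjmx R G)) s0.
    by rewrite es root_prod_XsubC mem_head.
  rewrite -eigenvalue_root_char => /eigenvalueP [v vA v0].
  apply: le_trans (ler_norm _) _; apply: eigenvalue_le_col_sum vA v0.
    by move=> i j; rewrite mxE ler0n.
  by move=> j; apply: adjmx_col_sum.
have s0_ge : d%:R <= s0.
  have : root (char_poly (adjmx R G)) d%:R by rewrite eq_q rootM root_XsubC eqxx.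
  rewrite es root_prod_XsubC inE => /predU1P [-> //|ds].
  move: srt; rewrite path_sortedE; last by move=> x y z /[swap]; apply: le_trans.
  by case/andP => /allP /(_ _ ds).
have s0d : s0 = d%:R by apply/le_anti/andP.
(* Cancelling one factor ['X - d%:R%:P] identifies the roots of [q] with the tail [s]. Every later
   eigenvalue, even a repeated [d], thus has an eigenvector orthogonal to [u]. *)
have qE : q = \prod_(x <- s) ('X - x%:P).
  have Xd0 : 'X - d%:R%:P != 0 :> {poly R} by rewrite polyXsubC_eq0.
  by apply: (mulfI Xd0); rewrite -eq_q es big_cons s0d.
have bound x : x \in s ->
    `|x| <= (1 + Num.sqrt (1 + 4 * (d%:R ^+ 2 + d%:R - n%:R))) / 2.
  (* The quadratic is taken at [|x|], whose square is [x ^+ 2]. *)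
  move=> xs; apply: le_quadratic_root; rewrite real_normK ?num_real // -cardG.
  have [|v [v0 vA vu]] := qroot x; first by rewrite qE root_prod_XsubC.
  exact: eigenvalue_orth_ones_bound vA vu.
(* Positions 1 and [#|G|.-1] of [s0 :: s] are the first and last positions of the nonempty [s], so
   neither entry is the default 0. *)
have sz : #|G|.-1 = size s by rewrite -ss.
have s_gt0 : (0 < size s)%N by rewrite -sz -subn1 subn_gt0.
rewrite ge_max sz -(prednK s_gt0) /= !bound // mem_nth // prednK //.
Qed.
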